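(* The following two statements are equivalent: (i) there is a positive constant $C$ such that for every real number $x > C$ the open interval $(x, x + \sqrt{x})$ contains a prime number; (ii) there is a positive integer $N$ such that for every integer $n > N$ the open interval $(p_n, p_n + \sqrt{p_n})$ contains a prime number.
   Context: $p_1 = 2 < p_2 = 3 < p_3 < \cdots$ denotes the increasing enumeration of all prime numbers, so $p_n$ is the $n$-th prime. *)

(* Defs.v *)
From mathcomp Require Import all_boot.

Set Implicit Arguments.
Unset Strict Implicit.
Unset Printing Implicit Defensive.

Fact prime_above_ex (m : nat) : exists p, (m < p) && prime p.
Proof. by have [p ltmp pr_p] := prime_above m; exists p; rewrite ltmp. Qed.

Definition next_prime (m : nat) : nat := ex_minn (prime_above_ex m).

(* Indexed from 1 (nth_prime 1 = 2, nth_prime 2 = 3); nth_prime 0 = 0 is not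
   a prime and only serves to start the iteration. *)
Definition nth_prime (n : nat) : nat := iter n next_prime 0.

Lemma nth_prime_prime n : 0 < n -> prime (nth_prime n).
Proof.
case: n => // n _; rewrite /nth_prime /= /next_prime.
by case: ex_minnP => p /andP[].
Qed.

Lemma nth_prime_ltS n : nth_prime n < nth_prime n.+1.
Proof.
by rewrite {2}/nth_prime /= /next_prime; case: ex_minnP => p /andP[].
Qed.

Lemma nth_prime_surj q : prime q -> exists2 n, 0 < n & nth_prime n = q.
Proof.
move=> pr_q; have le_id n : n <= nth_prime n.
  by elim: n => // n IHn; apply: leq_ltn_trans IHn (nth_prime_ltS n).
have exn : exists n, q <= nth_prime n by exists q.
case: (ex_minnP exn) => -[|n] le_q min_n.
  by move: le_q; rewrite leqNgt prime_gt0.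
exists n.+1 => //; apply/eqP; rewrite eqn_leq le_q andbT.
have lt_q : nth_prime n < q.
  by rewrite ltnNge; apply/negP => /min_n; rewrite ltnn.
rewrite {1}/nth_prime /= /next_prime; case: ex_minnP => p _; apply.
by rewrite lt_q.
Qed.

Example nth_prime1 : nth_prime 1 = 2.
Proof.
rewrite /nth_prime /= /next_prime; case: ex_minnP => p /andP[_ /prime_gt1 p_gt1].
by move/(_ 2 isT) => p_le2; apply/eqP; rewrite eqn_leq p_le2.
Qed.

(* Main.v *)
(* A prime in (p_n, p_n + sqrt p_n) is at least p_(n+1), so if p_n <= x < p_(n+1)
   then it exceeds x, and it lies below x + sqrt x by monotonicity of the square
   root. The converse holds because p_n >= n is unbounded. *)
Require Import Defs.
From mathcomp Require Import all_boot all_order all_algebra.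
From mathcomp Require Import reals.

Import Order.TTheory GRing.Theory Num.Theory.
Local Open Scope ring_scope.

Lemma leq_nth_prime n : (n <= nth_prime n)%N.
Proof. by elim: n => // n IHn; apply: leq_ltn_trans IHn (nth_prime_ltS n). Qed.

Lemma nth_prime_mono : {mono nth_prime : m n / (m <= n)%N}.
Proof. exact: leq_mono (homo_ltn ltn_trans nth_prime_ltS). Qed.

Lemma nth_primeS_le n q :
  prime q -> (nth_prime n < q)%N -> (nth_prime n.+1 <= q)%N.
Proof.
move=> pr_q lt_q; rewrite /nth_prime /= /next_prime.
by case: ex_minnP => p _; apply; rewrite lt_q.
Qed.

(** The least index whose value exceeds [x] exists since [nth_prime] is unbounded. It is a successor
    because [nth_prime 0 = 0 <= x]; for [x < 2] the bracket starts at this dummy value. *)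
Lemma nth_prime_bracket (R : realType) (x : R) : 0 <= x ->
  exists n, (nth_prime n)%:R <= x < (nth_prime n.+1)%:R.
Proof.
move=> x_ge0.
have ex_gt : exists n, x < (nth_prime n)%:R.
  exists (Num.truncn x).+1; apply: lt_le_trans (truncnS_gt x) _.
  by rewrite ler_nat leq_nth_prime.
case: (ex_minnP ex_gt) => -[|n]; first by rewrite ltNge x_ge0.
move=> ltx min_n; exists n; rewrite ltx andbT leNgt.
by apply/negP => /min_n; rewrite ltnn.
Qed.

Theorem theorem11 (R : realType) :
  (exists C : R, 0 < C /\
     forall x : R, C < x ->
       exists q : nat, prime q /\ q%:R \in `]x, x + Num.sqrt x[)
  <->
  (exists N : nat, (0 < N)%N /\
     forall n : nat, (N < n)%N ->
       exists q : nat, prime q /\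
         q%:R \in `]((nth_prime n)%:R : R),
                    (nth_prime n)%:R + Num.sqrt (nth_prime n)%:R[).
Proof.
split=> [[C [C_gt0 primeC]] | [N [N_gt0 primeN]]].
  (* The successor makes [N] positive and [C < N], whence [C < N < n <= nth_prime n]. *)
  exists (Num.truncn C).+1; split=> // n ltCn; apply: primeC.
  apply: lt_trans (truncnS_gt C) _; rewrite ltr_nat.
  exact: leq_trans ltCn (leq_nth_prime n).
(* The index is [N.+1] rather than [N] because [x] is bounded above by [nth_prime n.+1]: comparing
   indices then gives [N < n] strictly. *)
exists (nth_prime N.+1)%:R; split.
  by rewrite ltr0n (leq_trans _ (leq_nth_prime _)).
move=> x ltx; have x_ge0 : 0 <= x by apply: le_trans (ltW ltx); rewrite ler0n.
have [n /andP[lenx ltxn]] := nth_prime_bracket R x x_ge0.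
have ltNn : (N < n)%N.
  have: (nth_prime N.+1 < nth_prime n.+1)%N.
    by rewrite -(ltr_nat R) (lt_trans ltx).
  by rewrite (leqW_mono nth_prime_mono).
have [q [pr_q]] := primeN n ltNn; rewrite in_itv /= ltr_nat => /andP[ltnq ltq].
exists q; split=> //; rewrite in_itv /=; apply/andP; split.
  by apply: lt_le_trans ltxn _; rewrite ler_nat nth_primeS_le.
by apply: lt_le_trans ltq _; rewrite lerD // ler_wsqrtr.
Qed.
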